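(* Let $n\ge0$ and assume the generic conditions. For all $x,y$ with $x+y\ne0$ (with $x\notin S_1$ whenever a function $P^{(1)},P^{(2)}$ of $x$ or $f_1(x),g_1(x)$ occurs, and $y\notin S_2$ whenever a function $Q^{(1)},Q^{(2)}$ of $y$ or $f_2(y),g_2(y)$ occurs) the mixed kernels satisfy $$(x+y)K^{0,1}_{n}(x,y) = \hat{P}_{n}(x)\big( \check{Q}^{(1)}_{n}(y)-1 \big) + \tfrac{S_{n}}{S_{n+1}}\big[ P_{n}(x)Q^{(1)}_{n+1}(y)+P_{n+1}(x)Q^{(1)}_{n}(y) \big],$$ $$(x+y)K^{1,0}_{n}(x,y) = \big( \hat{P}^{(1)}_{n}(x)-1 \big)\check{Q}_{n}(y) + \tfrac{S_{n}}{S_{n+1}}\big[ P^{(1)}_{n}(x)Q_{n+1}(y)+P^{(1)}_{n+1}(x)Q_{n}(y) \big],$$ $$(x+y)K^{1,1}_{n}(x,y) = \big( \hat{P}^{(1)}_{n}(x)-1 \big)\big( \check{Q}^{(1)}_{n}(y)-1 \big) + \tfrac{S_{n}}{S_{n+1}}\big[ P^{(1)}_{n}(x)Q^{(1)}_{n+1}(y)+P^{(1)}_{n+1}(x)Q^{(1)}_{n}(y) \big],$$ $$(x+y)K^{0,2}_{n}(x,y) = \hat{P}_{n}(x)\check{Q}^{(2)}_{n}(y) + \tfrac{S_{n}}{S_{n+1}}\big[ P_{n}(x)Q^{(2)}_{n+1}(y)+P_{n+1}(x)Q^{(2)}_{n}(y) \big],$$ $$(x+y)K^{1,2}_{n}(x,y)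 = \big( \hat{P}^{(1)}_{n}(x)-1 \big)\check{Q}^{(2)}_{n}(y) + \tfrac{S_{n}}{S_{n+1}}\big[ P^{(1)}_{n}(x)Q^{(2)}_{n+1}(y)+P^{(1)}_{n+1}(x)Q^{(2)}_{n}(y) \big],$$ $$(x+y)K^{2,0}_{n}(x,y) = \hat{P}^{(2)}_{n}(x)\check{Q}_{n}(y) + \tfrac{S_{n}}{S_{n+1}}\big[ P^{(2)}_{n}(x)Q_{n+1}(y)+P^{(2)}_{n+1}(x)Q_{n}(y) \big],$$ $$(x+y)K^{2,1}_{n}(x,y) = \hat{P}^{(2)}_{n}(x)\big( \check{Q}^{(1)}_{n}(y)-1 \big) + \tfrac{S_{n}}{S_{n+1}}\big[ P^{(2)}_{n}(x)Q^{(1)}_{n+1}(y)+P^{(2)}_{n+1}(x)Q^{(1)}_{n}(y) \big],$$ $$(x+y)K^{2,2}_{n}(x,y) = \hat{P}^{(2)}_{n}(x)\check{Q}^{(2)}_{n}(y) + \tfrac{S_{n}}{S_{n+1}}\big[ P^{(2)}_{n}(x)Q^{(2)}_{n+1}(y)+P^{(2)}_{n+1}(x)Q^{(2)}_{n}(y) \big].$$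
   Context: Let $w_1,w_2$ be densities supported on $S_1,S_2\subset\mathbb R_+$, and $\langle f,g\rangle=\int_{S_1\times S_2}\frac{w_1(x)w_2(y)}{x+y}f(x)g(y)\,dx\,dy$. Put $M_{j,k}=\langle x^j,y^k\rangle$, $Z_0=1$, $Z_n=\det(M_{j,k})_{0\le j,k\le n-1}$. $P_n,Q_n$ are polynomials of degree $n$ with the same leading coefficient $S_n$ ($S_n^2=Z_n/Z_{n+1}$) and $\langle P_m,Q_n\rangle=\delta_{m,n}$. $\pi_n=\int_{S_1}w_1P_n\,dx$, $\eta_n=\int_{S_2}w_2Q_n\,dy$; $\hat P_n=-\sum_{k=0}^n\eta_kP_k$, $\check Q_n=-\sum_{j=0}^n\pi_jQ_j$. Generic conditions: all moments finite, $Z_n\ne0$, $\pi_n,\eta_n\ne0$ for all $n\ge0$. For a polynomial $P$ in $x$ (in particular $P_n$, $\hat P_n$): $P^{(1)}(z)=\int_{S_1}\frac{w_1(x)}{z-x}P(x)\,dx$ and $P^{(2)}(z)=\int_{S_1\times S_2}\frac{w_1(x)w_2(y)}{x+y}\frac{P(x)}{z-x}\,dx\,dy$, $z\in\mathbb C\setminus S_1$. For a polynomial $Q$ in $y$ (in particular $Q_n$, $\check Q_n$): $Q^{(1)}(z)=\int_{S_2}\frac{w_2(y)}{z-y}Q(y)\,dy$ and $Q^{(2)}(z)=\int_{S_1\times S_2}\frac{w_1(x)w_2(y)}{x+y}\frac{Q(y)}{z-y}\,dx\,dy$, $z\in\mathbb C\setminus S_2$. The functions $f_1,g_1$ are $P^{(1)},P^{(2)}$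 for $P=1$, and $f_2,g_2$ are $Q^{(1)},Q^{(2)}$ for $Q=1$. Kernels: $K^{0,1}_n=\sum_{l=0}^nP_l(x)Q^{(1)}_l(y)$; $K^{1,0}_n=\sum_{l=0}^nP^{(1)}_l(x)Q_l(y)$; $K^{1,1}_n=\sum_{l=0}^nP^{(1)}_l(x)Q^{(1)}_l(y)+\frac1{x+y}$; $K^{0,2}_n=\sum_{l=0}^nP_l(x)Q^{(2)}_l(y)-\frac1{x+y}$; $K^{1,2}_n=\sum_{l=0}^nP^{(1)}_l(x)Q^{(2)}_l(y)-\frac{f_1(x)}{x+y}$; $K^{2,0}_n=\sum_{l=0}^nP^{(2)}_l(x)Q_l(y)-\frac1{x+y}$; $K^{2,1}_n=\sum_{l=0}^nP^{(2)}_l(x)Q^{(1)}_l(y)-\frac{f_2(y)}{x+y}$; $K^{2,2}_n=\sum_{l=0}^nP^{(2)}_l(x)Q^{(2)}_l(y)-\frac{g_1(x)+g_2(y)}{x+y}$. *)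

(* Defs.v *)
From mathcomp Require Export all_boot all_order all_algebra.
From mathcomp Require Export all_classical all_reals all_analysis.
From mathcomp Require Export complex.

Set Implicit Arguments.
Unset Strict Implicit.
Unset Printing Implicit Defensive.

Import Order.TTheory GRing.Theory Num.Theory.
Import numFieldNormedType.Exports.

Local Open Scope classical_set_scope.
Local Open Scope ring_scope.
Local Open Scope complex_scope.

(* Integral of a complex-valued function, taken on the real and imaginary
   parts: MathComp-Analysis only integrates (extended) real functions. *)
Definition cintegral (R : realType) d (T : measurableType d)
    (mu : {measure set T -> \bar R}) (D : set T) (f : T -> R[i]) : R[i] :=
  (\int[mu]_(t in D) complex.Re (f t)) +i* (\int[mu]_(t in D) complex.Im (f t)).

(* No sign is imposed on w.  The support is closed, so that the Cauchy
   transforms below converge at every point off S. *)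
Definition density_supported_on (R : realType) (S : set R) (w : R -> R) : Prop :=
  [/\ closed S, (forall s, S s -> 0 <= s) & (forall s, ~ S s -> w s = 0)].

Definition off_support (R : realType) (S : set R) (z : R[i]) : Prop :=
  forall s : R, S s -> z <> s%:C.

Definition finite_moments (R : realType) (S : set R) (w : R -> R) : Prop :=
  forall j : nat, (@lebesgue_measure R).-integrable S
    (fun x => (w x * x ^+ j)%:E).

Section OneDensity.
Context {R : realType}.
Variables (S : set R) (w : R -> R).

(* pi_n and eta_n are the values at P_n and Q_n *)
Definition mean (p : {poly R[i]}) : R[i] :=
  cintegral (@lebesgue_measure R) S (fun s => (w s)%:C * p.[s%:C]).

(* p^(1), for polynomials in x or in y alike *)
Definition cauchy1 (p : {poly R[i]}) (z : R[i]) : R[i] :=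
  cintegral (@lebesgue_measure R) S (fun s => (w s)%:C / (z - s%:C) * p.[s%:C]).

End OneDensity.

Section TwoDensities.
Context {R : realType}.
Variables (S1 S2 : set R) (w1 w2 : R -> R).

Definition finite_bimoments : Prop :=
  forall j k : nat,
    ((@lebesgue_measure R) \x (@lebesgue_measure R))%E.-integrable (S1 `*` S2)
    (fun u => (w1 u.1 * w2 u.2 / (u.1 + u.2) * u.1 ^+ j * u.2 ^+ k)%:E).

(* The integrand takes a junk value where x + y = 0; inside S1 x S2 this can
   only happen at the origin, a null set. *)
Definition pairing (f g : R -> R[i]) : R[i] :=
  cintegral ((@lebesgue_measure R) \x (@lebesgue_measure R))%E (S1 `*` S2)
    (fun u => (w1 u.1 * w2 u.2 / (u.1 + u.2))%:C * f u.1 * g u.2).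

Definition bimoment (j k : nat) : R[i] :=
  pairing (fun x => x%:C ^+ j) (fun y => y%:C ^+ k).

(* equals 1 for n = 0 *)
Definition Z (n : nat) : R[i] := \det (\matrix_(j < n, k < n) bimoment j k).

(* P^(2), for P a polynomial in x *)
Definition cauchy2_x (p : {poly R[i]}) (z : R[i]) : R[i] :=
  pairing (fun x => p.[x%:C] / (z - x%:C)) (fun=> 1).

(* Q^(2), for Q a polynomial in y *)
Definition cauchy2_y (q : {poly R[i]}) (z : R[i]) : R[i] :=
  pairing (fun=> 1) (fun y => q.[y%:C] / (z - y%:C)).

Definition f1 : R[i] -> R[i] := cauchy1 S1 w1 1.
Definition g1 : R[i] -> R[i] := cauchy2_x 1.
Definition f2 : R[i] -> R[i] := cauchy1 S2 w2 1.
Definition g2 : R[i] -> R[i] := cauchy2_y 1.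

Variables P Q : nat -> {poly R[i]}.

Definition biorthogonal (S : nat -> R[i]) : Prop :=
  [/\ forall n, size (P n) = n.+1 /\ lead_coef (P n) = S n,
      forall n, size (Q n) = n.+1 /\ lead_coef (Q n) = S n,
      forall n, S n ^+ 2 = Z n / Z n.+1
    & forall m n, pairing (fun x => (P m).[x%:C]) (fun y => (Q n).[y%:C])
                  = (m == n)%:R].

Definition hatP (n : nat) : {poly R[i]} :=
  - \sum_(k < n.+1) mean S2 w2 (Q k) *: P k.

Definition checkQ (n : nat) : {poly R[i]} :=
  - \sum_(j < n.+1) mean S1 w1 (P j) *: Q j.

Notation P1 l := (cauchy1 S1 w1 (P l)).
Notation P2 l := (cauchy2_x (P l)).
Notation Q1 l := (cauchy1 S2 w2 (Q l)).
Notation Q2 l := (cauchy2_y (Q l)).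

Definition K01 (n : nat) (x y : R[i]) : R[i] :=
  \sum_(l < n.+1) (P l).[x] * Q1 l y.

Definition K10 (n : nat) (x y : R[i]) : R[i] :=
  \sum_(l < n.+1) P1 l x * (Q l).[y].

Definition K11 (n : nat) (x y : R[i]) : R[i] :=
  \sum_(l < n.+1) P1 l x * Q1 l y + 1 / (x + y).

Definition K02 (n : nat) (x y : R[i]) : R[i] :=
  \sum_(l < n.+1) (P l).[x] * Q2 l y - 1 / (x + y).

Definition K12 (n : nat) (x y : R[i]) : R[i] :=
  \sum_(l < n.+1) P1 l x * Q2 l y - f1 x / (x + y).

Definition K20 (n : nat) (x y : R[i]) : R[i] :=
  \sum_(l < n.+1) P2 l x * (Q l).[y] - 1 / (x + y).

Definition K21 (n : nat) (x y : R[i]) : R[i] :=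
  \sum_(l < n.+1) P2 l x * Q1 l y - f2 y / (x + y).

Definition K22 (n : nat) (x y : R[i]) : R[i] :=
  \sum_(l < n.+1) P2 l x * Q2 l y - (g1 x + g2 y) / (x + y).

End TwoDensities.

(* Main.v *)
(* Testing the Christoffel-Darboux identity for the Cauchy biorthogonal
   polynomials against a linear functional phi in x and a linear functional psi
   in y gives all kernels at once.  Since x + y cancels the Cauchy kernel,
   <xp, q> + <p, yq> = (int p w1)(int q w2); expanding x P_l in the P_k and
   y Q_l in the Q_k leaves a rank-one part, hatP checkQ, and the boundary terms
   of index n + 1.  Evaluation at x, p |-> p^(1)(x) and p |-> p^(2)(x) all satisfy
   phi(X p) = x phi(p) - alpha(p), with alpha equal to 0, to the mean, and to
   <p, 1> respectively.  The sums involving alpha collapse to -psi(checkQ) or, by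
   the reproducing property, to psi(1): these are the corrections in the kernels. *)

Require Import Defs.
From mathcomp Require Import ring lra measurable_realfun.

Set Implicit Arguments.
Unset Strict Implicit.
Unset Printing Implicit Defensive.
Import Order.TTheory GRing.Theory Num.Theory.
Import numFieldNormedType.Exports.
Local Open Scope classical_set_scope.
Local Open Scope ring_scope.
Local Open Scope complex_scope.

(** * Biorthogonal expansions *)

Section ScalarFunctionals.
Context {F : fieldType} {V : lmodType F}.
Variable phi : V -> F.
Hypothesis phi_scalar : scalar phi.

Lemma scalar0 : phi 0 = 0.
Proof.
have := phi_scalar (-1) 0 0.
by rewrite scaler0 addr0 mulN1r addNr.
Qed.

Lemma scalar_sum (n : nat) (c : nat -> F) (v : nat -> V) :
  phi (\sum_(i < n) c i *: v i) = \sum_(i < n) c i * phi (v i).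
Proof.
elim: n => [|n IHn]; first by rewrite !big_ord0 scalar0.
by rewrite !big_ord_recr /= addrC phi_scalar IHn addrC.
Qed.

Lemma scalarN v : phi (- v) = - phi v.
Proof. by have := phi_scalar (-1) v 0; rewrite scalar0 !addr0 scaleN1r mulN1r. Qed.

End ScalarFunctionals.

Lemma eq_scalar (F : fieldType) (V : lmodType F) (f g : V -> F) :
  f =1 g -> scalar f -> scalar g.
Proof. by move=> fg fs a p q; rewrite -!fg fs. Qed.

Lemma horner_scalar (F : fieldType) (x : F) : scalar (fun p : {poly F} => p.[x]).
Proof. by move=> a p q; rewrite hornerD hornerZ. Qed.

Lemma horner_mulX (F : fieldType) (x : F) (p : {poly F}) :
  ('X * p).[x] = x * p.[x].
Proof. by rewrite mulrC hornerMX mulrC. Qed.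

Section Expansion.
Context {F : fieldType}.
Variables (B : {poly F} -> {poly F} -> F) (P Q : nat -> {poly F}) (S : nat -> F).
Hypothesis B_scalar : forall q, scalar (B^~ q).
Hypothesis sizeP : forall n, size (P n) = n.+1 /\ lead_coef (P n) = S n.
Hypothesis B_PQ : forall m n, B (P m) (Q n) = (m == n)%:R.

Lemma biorth_lead_neq0 n : S n != 0.
Proof.
have [szP <-] := sizeP n.
by rewrite lead_coef_eq0 -size_poly_gt0 szP.
Qed.

Lemma biorth_coef_diag n : (P n)`_n = S n.
Proof. by have [szP <-] := sizeP n; rewrite lead_coefE szP. Qed.

(** Induction on the size bound: a multiple of [P n] removes the coefficient of degree [n], and
    pairing with [Q k] then reads off each coefficient. *)
Lemma biorth_expansion n (p : {poly F}) : (size p <= n)%N ->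
  p = \sum_(k < n) B p (Q k) *: P k.
Proof.
elim: n p => [|n IHn] p szp.
  by rewrite big_ord0; apply/eqP; rewrite -size_poly_leq0.
set c := p`_n / S n.
pose r := p - c *: P n.
have pE : p = c *: P n + r by rewrite addrC subrK.
have szr : (size r <= n)%N.
  apply/leq_sizeP => j; rewrite leq_eqVlt => /orP[/eqP <-|ltnj].
    by rewrite coefB coefZ biorth_coef_diag divfK ?subrr// biorth_lead_neq0.
  rewrite coefB coefZ !nth_default ?mulr0 ?subr0//.
    by rewrite (sizeP n).1.
  exact: leq_trans ltnj.
(* The remainder lies in the span of the [P k] with [k < n], all of which pair to zero with
   [Q n]. *)
have BrQn : B r (Q n) = 0.
  rewrite (IHn _ szr) (scalar_sum (B_scalar (Q n)) n (fun k => B r (Q k)) P).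
  by apply: big1 => k _; rewrite B_PQ ltn_eqF ?mulr0.
rewrite big_ord_recr /= {1}pE [LHS]addrC {1}(IHn _ szr).
congr (_ + _ *: _); last by rewrite pE B_scalar BrQn B_PQ eqxx mulr1 addr0.
apply: eq_bigr => k _.
by rewrite pE B_scalar B_PQ gtn_eqF // mulr0 add0r.
Qed.

(** In the expansion of [p] only [P n] reaches degree [n], and its leading coefficient is [S n].
    This is where the ratio [S n / S n.+1] of the boundary terms comes from. *)
Lemma biorth_coef n (p : {poly F}) : (size p <= n.+1)%N ->
  B p (Q n) = p`_n / S n.
Proof.
move=> szp; apply: (canRL (mulfK (biorth_lead_neq0 n))).
rewrite {2}(biorth_expansion szp) coef_sum big_ord_recr /= coefZ.
rewrite biorth_coef_diag big1 ?add0r // => k _.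
by rewrite coefZ nth_default ?mulr0 // (sizeP k).1.
Qed.

(** Since ['X * P l] has degree [l + 1 <= n + 1], its expansion stops at [P n.+1]. The coefficient
    there is that of degree [n] in [P l] divided by [S n.+1], which vanishes unless [l = n]. *)
Lemma biorth_mulX_expansion n l (phi : {poly F} -> F) : scalar phi -> (l <= n)%N ->
  phi ('X * P l) = \sum_(k < n.+1) B ('X * P l) (Q k) * phi (P k)
                   + (l == n)%:R * (S n / S n.+1) * phi (P n.+1).
Proof.
move=> phi_scalar leln.
have szXP : (size ('X * P l : {poly F})%R <= n.+2)%N.
  by rewrite mulrC size_mulX ?(sizeP l).1 // -size_poly_eq0 (sizeP l).1.
rewrite {1}(biorth_expansion szXP).
rewrite (scalar_sum phi_scalar _ (fun k => B ('X * P l) (Q k)) P).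
rewrite big_ord_recr /= biorth_coef // coefXM /=; congr (_ + _ * _).
case: eqVneq => [->|neln]; first by rewrite biorth_coef_diag mul1r.
by rewrite nth_default ?mul0r// (sizeP l).1 ltn_neqAle neln.
Qed.

End Expansion.

(** * The Christoffel-Darboux identity for an abstract pairing *)

Section ChristoffelDarboux.
Context {F : fieldType}.
Variables (B : {poly F} -> {poly F} -> F) (m1 m2 : {poly F} -> F).
Variables (P Q : nat -> {poly F}) (S : nat -> F).
Hypothesis B_scalarl : forall q, scalar (B^~ q).
Hypothesis B_scalarr : forall p, scalar (B p).
Hypothesis B_mulX : forall p q, B ('X * p) q + B p ('X * q) = m1 p * m2 q.
Hypothesis sizeP : forall n, size (P n) = n.+1 /\ lead_coef (P n) = S n.
Hypothesis sizeQ : forall n, size (Q n) = n.+1 /\ lead_coef (Q n) = S n.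
Hypothesis B_PQ : forall m n, B (P m) (Q n) = (m == n)%:R.

(** The transposed pairing lets the expansions in the [P k] serve for the [Q k] as well. *)
Let Bt q p := B p q.

Let Bt_QP m n : Bt (Q m) (P n) = (m == n)%:R.
Proof. by rewrite /Bt B_PQ eq_sym. Qed.

(* Bilinear form of the Christoffel-Darboux identity: it is the identity for
   the two-variable polynomials, tested against [phi] in [x] and [psi] in [y]. *)
Lemma christoffel_darboux (phi psi : {poly F} -> F) n :
  scalar phi -> scalar psi ->
  \sum_(l < n.+1) (phi ('X * P l) * psi (Q l) + phi (P l) * psi ('X * Q l))
  = (\sum_(k < n.+1) m2 (Q k) * phi (P k)) * (\sum_(l < n.+1) m1 (P l) * psi (Q l))
    + S n / S n.+1 * (phi (P n) * psi (Q n.+1) + phi (P n.+1) * psi (Q n)).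
Proof.
move=> phi_s psi_s.
pose a l := \sum_(k < n.+1) B ('X * P l) (Q k) * phi (P k).
pose b l := \sum_(k < n.+1) B (P k) ('X * Q l) * psi (Q k).
(* [a] and [b] collect the components of index at most [n]; the indicator isolates the overflow into
   index [n + 1]. *)
transitivity (\sum_(l < n.+1) (a l * psi (Q l) + phi (P l) * b l) +
  \sum_(l < n.+1) ((l : nat) == n)%:R * (S n / S n.+1) *
     (phi (P l) * psi (Q n.+1) + phi (P n.+1) * psi (Q l))).
  rewrite -big_split /=; apply: eq_bigr => l _.
  rewrite (biorth_mulX_expansion B_scalarl sizeP B_PQ phi_s (leq_ord l)).
  rewrite (biorth_mulX_expansion (B := Bt) B_scalarr sizeQ Bt_QP psi_s (leq_ord l)).
  by rewrite -/(a l) -/(b l); ring.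
congr (_ + _); last first.
  rewrite big_ord_recr /= eqxx mul1r big1 ?add0r // => l _.
  by rewrite ltn_eqF ?mul0r.
rewrite big_split /= mulrC [RHS]big_distrl /=.
under [X in X + _]eq_bigr do rewrite big_distrl /=.
under [X in _ + X]eq_bigr do rewrite big_distrr /=.
(* After the exchange both double sums carry [phi (P k) * psi (Q l)], with coefficients
   [B ('X * P l) (Q k)] and [B (P l) ('X * Q k)]; [B_mulX] turns their sum into a rank-one
   product. *)
rewrite [X in _ + X]exchange_big /= -big_split.
apply: eq_bigr => l _; rewrite -big_split big_distrr /=.
apply: eq_bigr => k _.
transitivity ((m1 (P l) * m2 (Q k)) * (phi (P k) * psi (Q l))); last by ring.
by rewrite -B_mulX; ring.
Qed.

(* The functionals of interest are multiplication operators up to a defect: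
   [phi ('X * p) = x * phi p - alpha p]. *)
Lemma christoffel_darboux_defect (phi psi alpha beta : {poly F} -> F) (x y : F) n :
  scalar phi -> scalar psi ->
  (forall p, phi ('X * p) = x * phi p - alpha p) ->
  (forall q, psi ('X * q) = y * psi q - beta q) ->
  (x + y) * \sum_(l < n.+1) phi (P l) * psi (Q l)
  = (\sum_(k < n.+1) m2 (Q k) * phi (P k)) * (\sum_(l < n.+1) m1 (P l) * psi (Q l))
    + S n / S n.+1 * (phi (P n) * psi (Q n.+1) + phi (P n.+1) * psi (Q n))
    + \sum_(l < n.+1) alpha (P l) * psi (Q l)
    + \sum_(l < n.+1) beta (Q l) * phi (P l).
Proof.
move=> phi_s psi_s phiX psiX.
rewrite -christoffel_darboux // -!big_split big_distrr /=.
by apply: eq_bigr => l _; rewrite phiX psiX; ring.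
Qed.

(** The truncated expansion of the constant [1] in the [Q k] is exact for every [n], as [1] has
    degree zero. *)
Lemma biorth_reproducing_one_r (psi : {poly F} -> F) n : scalar psi ->
  \sum_(l < n.+1) B (P l) 1 * psi (Q l) = psi 1.
Proof.
move=> psi_s; rewrite {2}(biorth_expansion (B := Bt) B_scalarr sizeQ Bt_QP (n := n.+1) (p := 1)).
  by rewrite (scalar_sum psi_s _ (fun k => B (P k) 1) Q).
by rewrite size_poly1.
Qed.

Lemma biorth_reproducing_one_l (phi : {poly F} -> F) n : scalar phi ->
  \sum_(l < n.+1) B 1 (Q l) * phi (P l) = phi 1.
Proof.
move=> phi_s; rewrite {2}(biorth_expansion B_scalarl sizeP B_PQ (n := n.+1) (p := 1)).
  by rewrite (scalar_sum phi_s _ (fun k => B 1 (Q k)) P).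
by rewrite size_poly1.
Qed.

End ChristoffelDarboux.

(** * Complex-valued integrals *)

Lemma complexReM (R : rcfType) (a b : R[i]) :
  complex.Re (a * b) = complex.Re a * complex.Re b - complex.Im a * complex.Im b.
Proof. by case: a b => [? ?] [? ?]. Qed.

Lemma complexImM (R : rcfType) (a b : R[i]) :
  complex.Im (a * b) = complex.Re a * complex.Im b + complex.Im a * complex.Re b.
Proof. by case: a b => [? ?] [? ?]. Qed.

Lemma complexReD (R : rcfType) (a b : R[i]) :
  complex.Re (a + b) = complex.Re a + complex.Re b.
Proof. by case: a b => [? ?] [? ?]. Qed.

Lemma complexImD (R : rcfType) (a b : R[i]) :
  complex.Im (a + b) = complex.Im a + complex.Im b.
Proof. by case: a b => [? ?] [? ?]. Qed.

Definition cintegrable (R : realType) d (T : measurableType d)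
    (mu : {measure set T -> \bar R}) (D : set T) (f : T -> R[i]) : Prop :=
  mu.-integrable D (fun t => (complex.Re (f t))%:E) /\
  mu.-integrable D (fun t => (complex.Im (f t))%:E).

Section ComplexIntegral.
Context {R : realType} {d : measure_display} {T : measurableType d}.
Context {mu : {measure set T -> \bar R}} {D : set T} (mD : measurable D).
Implicit Types (f g : T -> R[i]) (a b : R[i]).

Lemma eq_cintegral f g : (forall t, D t -> f t = g t) ->
  cintegral mu D f = cintegral mu D g.
Proof.
by move=> fg; congr Complex; apply: eq_Rintegral => t /set_mem Dt; rewrite fg.
Qed.

Lemma eq_cintegrable f g : (forall t, D t -> f t = g t) ->
  cintegrable mu D f -> cintegrable mu D g.
Proof.
by move=> fg [fr fi]; split; [move: fr|move: fi]; apply: eq_integrable => // t /set_mem Dt;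
  rewrite fg.
Qed.

Lemma integrable_lincomb (r s : R) (f g : T -> R) :
  mu.-integrable D (fun t => (f t)%:E) -> mu.-integrable D (fun t => (g t)%:E) ->
  mu.-integrable D (fun t => (r * f t + s * g t)%:E).
Proof.
move=> fi gi; apply: (@integrableD _ _ _ mu D mD (fun t => (r * f t)%:E) (fun t => (s * g t)%:E)).
- exact: (@integrableZl _ _ _ mu D mD r _ fi).
- exact: (@integrableZl _ _ _ mu D mD s _ gi).
Qed.

Lemma Rintegral_lincomb (r s : R) (f g : T -> R) :
  mu.-integrable D (fun t => (f t)%:E) -> mu.-integrable D (fun t => (g t)%:E) ->
  \int[mu]_(t in D) (r * f t + s * g t) =
  r * \int[mu]_(t in D) f t + s * \int[mu]_(t in D) g t.
Proof.
move=> fi gi; rewrite RintegralD //; first by rewrite !RintegralZl.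
- exact: (@integrableZl _ _ _ mu D mD r _ fi).
- exact: (@integrableZl _ _ _ mu D mD s _ gi).
Qed.

Lemma cintegrable_lincomb a b f g : cintegrable mu D f -> cintegrable mu D g ->
  cintegrable mu D (fun t => a * f t + b * g t).
Proof.
move=> [fr fi] [gr gi].
have fa := integrable_lincomb (complex.Re a) (- complex.Im a) fr fi.
have gb := integrable_lincomb (complex.Re b) (- complex.Im b) gr gi.
have fa' := integrable_lincomb (complex.Re a) (complex.Im a) fi fr.
have gb' := integrable_lincomb (complex.Re b) (complex.Im b) gi gr.
split; [move: (integrable_lincomb 1 1 fa gb)|move: (integrable_lincomb 1 1 fa' gb')];
  apply: eq_integrable => // t _; rewrite ?complexReD ?complexImD ?complexReM ?complexImM;
  congr EFin; ring.
Qed.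

Lemma cintegral_lincomb a b f g : cintegrable mu D f -> cintegrable mu D g ->
  cintegral mu D (fun t => a * f t + b * g t) =
  a * cintegral mu D f + b * cintegral mu D g.
Proof.
move=> [fr fi] [gr gi].
have fa := integrable_lincomb (complex.Re a) (- complex.Im a) fr fi.
have gb := integrable_lincomb (complex.Re b) (- complex.Im b) gr gi.
have fa' := integrable_lincomb (complex.Re a) (complex.Im a) fi fr.
have gb' := integrable_lincomb (complex.Re b) (complex.Im b) gi gr.
have reE := etrans (Rintegral_lincomb 1 1 fa gb) (congr2 (fun r s => 1 * r + 1 * s)
  (Rintegral_lincomb _ _ fr fi) (Rintegral_lincomb _ _ gr gi)).
have imE := etrans (Rintegral_lincomb 1 1 fa' gb') (congr2 (fun r s => 1 * r + 1 * s)
  (Rintegral_lincomb _ _ fi fr) (Rintegral_lincomb _ _ gi gr)).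
apply/eqP; rewrite eq_complex complexReD complexImD !complexReM !complexImM /=.
apply/andP; split; apply/eqP.
  apply: etrans (etrans reE _); last by ring.
  by apply: eq_Rintegral => t _; rewrite complexReD !complexReM; ring.
apply: etrans (etrans imE _); last by ring.
by apply: eq_Rintegral => t _; rewrite complexImD !complexImM; ring.
Qed.

Lemma cintegrable_bounded_mul f g :
  measurable_fun D (fun t => complex.Re (g t)) ->
  measurable_fun D (fun t => complex.Im (g t)) ->
  [bounded complex.Re (g t) | t in D] -> [bounded complex.Im (g t) | t in D] ->
  cintegrable mu D f -> cintegrable mu D (fun t => f t * g t).
Proof.
move=> mgr mgi bgr bgi [fr fi].
have rr := integrableMl mD fr mgr bgr; have ri := integrableMl mD fr mgi bgi.
have ir := integrableMl mD fi mgr bgr; have ii := integrableMl mD fi mgi bgi.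
split.
- have := integrable_lincomb 1 (-1) rr ii.
  by apply: eq_integrable => // t _ /=; rewrite complexReM; congr EFin; ring.
- have := integrable_lincomb 1 1 ri ir.
  by apply: eq_integrable => // t _ /=; rewrite complexImM; congr EFin; ring.
Qed.

Lemma cintegrable_real (f : T -> R) :
  mu.-integrable D (fun t => (f t)%:E) -> cintegrable mu D (fun t => (f t)%:C).
Proof. by move=> fi; split => //; exact: integrable0. Qed.

(** Induction along Horner's scheme. The weight [k] varies in the induction so that it can absorb
    one factor [e] at each step. *)
Lemma cintegrable_horner (e : T -> R) (k : T -> R[i]) (p : {poly R[i]}) :
  (forall j, cintegrable mu D (fun t => k t * (e t)%:C ^+ j)) ->
  cintegrable mu D (fun t => k t * p.[(e t)%:C]).
Proof.
elim/poly_ind: p k => [|p c IHp] k ki.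
  apply: (eq_cintegrable (f := fun=> 0)) => [t _|]; first by rewrite horner0 mulr0.
  by split; exact: integrable0.
have kei : cintegrable mu D (fun t => (k t * (e t)%:C) * p.[(e t)%:C]).
  by apply: IHp => j; apply: eq_cintegrable (ki j.+1) => t _; rewrite exprS mulrA.
apply: eq_cintegrable (cintegrable_lincomb 1 c kei (ki 0)) => t _.
by rewrite hornerMXaddC expr0; ring.
Qed.

Lemma cintegral_horner_scalar (e : T -> R) (k : T -> R[i]) :
  (forall j, cintegrable mu D (fun t => k t * (e t)%:C ^+ j)) ->
  scalar (fun p : {poly R[i]} => cintegral mu D (fun t => k t * p.[(e t)%:C])).
Proof.
move=> ki a p q.
have := cintegral_lincomb a 1 (cintegrable_horner p ki) (cintegrable_horner q ki).
rewrite mul1r => <-; apply: eq_cintegral => t _.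
by rewrite hornerD hornerZ; ring.
Qed.

(* [e] parametrizes the variable: it is the identity or a projection of the plane. *)
Lemma cauchy_horner_mulX (e : T -> R) (k : T -> R[i]) (z : R[i]) (p : {poly R[i]}) :
  (forall t, D t -> z <> (e t)%:C) ->
  (forall j, cintegrable mu D (fun t => k t * (e t)%:C ^+ j)) ->
  (forall j, cintegrable mu D (fun t => k t / (z - (e t)%:C) * (e t)%:C ^+ j)) ->
  cintegral mu D (fun t => k t / (z - (e t)%:C) * ('X * p).[(e t)%:C]) =
  z * cintegral mu D (fun t => k t / (z - (e t)%:C) * p.[(e t)%:C])
  - cintegral mu D (fun t => k t * p.[(e t)%:C]).
Proof.
move=> ze ki kzi.
rewrite -mulN1r -cintegral_lincomb; [|exact: cintegrable_horner..].
(* Pointwise this is [s / (z - s) = z / (z - s) - 1] at [s = e t]. *)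
apply: eq_cintegral => t Dt; rewrite (mulrC 'X p) hornerMX.
have zet : z - (e t)%:C != 0 by rewrite subr_eq0; apply/eqP/ze.
by field.
Qed.

End ComplexIntegral.

(** * Boundedness of the resolvent [1 / (z - s)] off the support *)

Section Resolvent.
Context {R : realType}.

(** For [z] off the real axis the imaginary part bounds the distance to [S]; for real [z] the open
    complement of [S] contains a ball around [z]. *)
Lemma off_support_dist (S : set R) (z : R[i]) : closed S -> off_support S z ->
  exists2 e : R, 0 < e &
    forall s, S s -> e ^+ 2 <= (complex.Re z - s) ^+ 2 + complex.Im z ^+ 2.
Proof.
move=> cS; case: z => a b offS /=.
have [b0|b0] := eqVneq b 0.
  have nSa : (~` S) a by move=> Sa; apply: (offS a Sa); rewrite b0.
  have /nbhs_ballP[e /= e0 aeS] := open_nbhs_nbhs (conj (closed_openC cS) nSa).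
  exists e => // s Ss.
  have : ~ ball a e s by move=> /aeS /(_ Ss).
  rewrite /ball /= => /negP; rewrite -leNgt b0 expr0n addr0 => eas.
  by rewrite -[leRHS]real_normK ?num_real// lerXn2r ?nnegrE// ltW.
exists (`|b|); first by rewrite normr_gt0.
by move=> s _; rewrite real_normK ?num_real// lerDr sqr_ge0.
Qed.

Lemma complexReV (z : R[i]) :
  complex.Re z^-1 = complex.Re z / (complex.Re z ^+ 2 + complex.Im z ^+ 2).
Proof. by case: z. Qed.

Lemma complexImV (z : R[i]) :
  complex.Im z^-1 = - complex.Im z / (complex.Re z ^+ 2 + complex.Im z ^+ 2).
Proof. by case: z => a b /=; rewrite mulNr. Qed.

(** Expanding [(|a| - e)^2 >= 0] gives [2 e |a| <= a^2 + e^2 <= 2 (a^2 + b^2)]. *)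
Lemma normr_div_sum_sqr_le (e a b : R) : 0 < e -> e ^+ 2 <= a ^+ 2 + b ^+ 2 ->
  `|a / (a ^+ 2 + b ^+ 2)| <= e^-1.
Proof.
move=> e0 le_e; have n0 : 0 < a ^+ 2 + b ^+ 2 by apply: lt_le_trans le_e; rewrite exprn_gt0.
rewrite normrM normfV (gtr0_norm n0) ler_pdivrMr // mulrC ler_pdivlMr //.
have := sqr_ge0 b; have := sqr_ge0 (`|a| - e) .
rewrite sqrrB real_normK ?num_real // => h1 h2; nra.
Qed.

(** The real and imaginary parts of [1 / (z - s)] are continuous on [S] and bounded there by the
    inverse distance, so multiplying by them preserves integrability. *)
Lemma cintegrable_resolvent d (T : measurableType d) (mu : {measure set T -> \bar R})
    (D : set T) (S : set R) (e : T -> R) (f : T -> R[i]) (z : R[i]) :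
  measurable D -> closed S -> off_support S z -> measurable_fun D e ->
  (forall t, D t -> S (e t)) ->
  cintegrable mu D f -> cintegrable mu D (fun t => f t / (z - (e t)%:C)).
Proof.
move=> mD cS offS me DS.
have [r r0 rz] := off_support_dist cS offS.
set a := complex.Re z in rz; set b := complex.Im z in rz.
have reE t : complex.Re (z - (e t)%:C)^-1 = (a - e t) / ((a - e t) ^+ 2 + b ^+ 2).
  by rewrite complexReV complexReD complexImD /= subr0.
have imE t : complex.Im (z - (e t)%:C)^-1 = - b / ((a - e t) ^+ 2 + b ^+ 2).
  by rewrite complexImV complexReD complexImD /= subr0.
(* Continuity is asked only at points of [S]: for real [z] the inverse of [den] below is singular at
   [z] itself. *)
have mcomp (h : R -> R) : (forall s, S s -> {for s, continuous h}) ->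
    measurable_fun D (h \o e).
  move=> ch; apply: (measurable_comp (closed_measurable cS)) me => [_ [t Dt <-]|].
    exact: DS.
  apply: subspace_continuous_measurable_fun; first exact: closed_measurable.
  by apply: continuous_in_subspaceT => s /set_mem /ch.
pose num (s : R) := a - s; pose den (s : R) := (a - s) ^+ 2 + b ^+ 2.
have cnum (s : R) : {for s, continuous num}.
  by apply: continuousB; [exact: cvg_cst|exact: cvg_id].
have cden (s : R) : {for s, continuous den}.
  by apply: continuousD; [exact: (continuousM (cnum s) (cnum s))|exact: cvg_cst].
have cVden (s : R) : S s -> {for s, continuous (fun s => (den s)^-1)}.
  move=> Ss; apply: continuousV => //.
  by rewrite gt_eqF // (lt_le_trans _ (rz s Ss)) // exprn_gt0.
apply: cintegrable_bounded_mul => //.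
- under eq_fun do rewrite reE.
  apply: (mcomp (fun s => num s / den s)) => s Ss.
  exact: continuousM (cnum s) (cVden s Ss).
- under eq_fun do rewrite imE.
  apply: (mcomp (fun s => - b / den s)) => s Ss.
  by apply: continuousM (cVden s Ss); exact: cvg_cst.
- exists r^-1; split; first exact: num_real.
  move=> M rM t Dt /=; rewrite reE (le_trans _ (ltW rM)) //.
  by apply: normr_div_sum_sqr_le => //; exact/rz/DS.
- exists r^-1; split; first exact: num_real.
  (* The same bound with the two squares exchanged, the numerator now being [b]. *)
  move=> M rM t Dt /=; rewrite imE (le_trans _ (ltW rM)) // mulNr normrN addrC.
  by apply: normr_div_sum_sqr_le => //; rewrite addrC; exact/rz/DS.
Qed.

End Resolvent.

(** * Integrals of tensor products over a product measure *)

Section TensorIntegral.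
Context {d1 d2 : measure_display} {T1 : measurableType d1} {T2 : measurableType d2}.
Context {R : realType}.
Variables (m1 : {sigma_finite_measure set T1 -> \bar R}).
Variables (m2 : {sigma_finite_measure set T2 -> \bar R}).
Variables (D1 : set T1) (D2 : set T2) (f : T1 -> R) (g : T2 -> R).
Hypothesis mD1 : measurable D1.
Hypothesis mD2 : measurable D2.
Hypothesis f_int : m1.-integrable D1 (fun x => (f x)%:E).
Hypothesis g_int : m2.-integrable D2 (fun y => (g y)%:E).

Let mD12 : measurable (D1 `*` D2). Proof. exact: measurableX. Qed.

(** Extension by zero commutes with the tensor product, which reduces the claims to Fubini and
    Tonelli on the whole space. *)
Let restrict_tensor : (fun u => (f u.1 * g u.2)%:E) \_ (D1 `*` D2) =
  fun u => ((f \_ D1) u.1 * (g \_ D2) u.2)%:E.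
Proof.
apply/funext => -[x y]; rewrite !patchE /= in_setX /=.
by case: (x \in D1); case: (y \in D2); rewrite ?mul0r ?mulr0.
Qed.

Let f_int' : m1.-integrable setT (fun x => ((f \_ D1) x)%:E).
Proof. by move/(integrable_mkcond _ mD1): f_int; rewrite restrict_EFin. Qed.

Let g_int' : m2.-integrable setT (fun y => ((g \_ D2) y)%:E).
Proof. by move/(integrable_mkcond _ mD2): g_int; rewrite restrict_EFin. Qed.

(** By Tonelli the iterated integral of the absolute value is the product of the two norms, which
    are finite. *)
Let tensor_int' :
  (m1 \x m2)%E.-integrable setT (fun u => ((f \_ D1) u.1 * (g \_ D2) u.2)%:E).
Proof.
have mf : measurable_fun setT (f \_ D1).
  by apply/measurable_EFinP; exact: measurable_int f_int'.
have mg : measurable_fun setT (g \_ D2).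
  by apply/measurable_EFinP; exact: measurable_int g_int'.
apply/integrable12ltyP.
  apply/measurable_EFinP; apply: measurable_funM.
    exact: (measurableT_comp mf measurable_fst).
  exact: (measurableT_comp mg measurable_snd).
have /integrableP[_ If] := f_int'; have /integrableP[_ Ig] := g_int'.
have Igfin : (\int[m2]_y `|((g \_ D2) y)%:E|)%E \is a fin_num.
  by rewrite ge0_fin_numE// integral_ge0.
rewrite (eq_integral (fun x => `|((f \_ D1) x)%:E| * \int[m2]_y `|((g \_ D2) y)%:E|)%E).
  rewrite -(fineK Igfin) ge0_integralZr //=; last by rewrite lee_fin fine_ge0 // integral_ge0.
    by rewrite fineK // lte_mul_pinfty // ?integral_ge0 // ge0_fin_numE // integral_ge0.
  by apply/measurable_EFinP; exact: measurableT_comp.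
move=> x _; rewrite -ge0_integralZl //=.
  by apply: eq_integral => y _; rewrite normrM EFinM.
by apply/measurable_EFinP; exact: measurableT_comp.
Qed.

Lemma integrable_tensor :
  (m1 \x m2)%E.-integrable (D1 `*` D2) (fun u => (f u.1 * g u.2)%:E).
Proof. by apply/(integrable_mkcond _ mD12); rewrite restrict_tensor. Qed.

Lemma Rintegral_tensor :
  \int[(m1 \x m2)%E]_(u in D1 `*` D2) (f u.1 * g u.2) =
  (\int[m1]_(x in D1) f x) * (\int[m2]_(y in D2) g y).
Proof.
rewrite /Rintegral [in LHS]integral_mkcond restrict_tensor.
rewrite -(integral12_prod_meas1 tensor_int') /fubini_F /=.
rewrite [in RHS]integral_mkcond restrict_EFin.
rewrite [X in _ * fine X]integral_mkcond restrict_EFin.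
(* [fine] is multiplicative only on finite values, and a finite inner integral can be pulled out as
   a constant. *)
have Igfin := integrable_fin_num measurableT g_int'.
have Iffin := integrable_fin_num measurableT f_int'.
rewrite -fineM //; congr fine.
rewrite -(fineK Igfin) -integralZr //; apply: eq_integral => x _.
rewrite (fineK Igfin) -integralZl //.
Qed.

End TensorIntegral.

Section TensorComplexIntegral.
Context {d1 d2 : measure_display} {T1 : measurableType d1} {T2 : measurableType d2}.
Context {R : realType}.
Variables (m1 : {sigma_finite_measure set T1 -> \bar R}).
Variables (m2 : {sigma_finite_measure set T2 -> \bar R}).
Variables (D1 : set T1) (D2 : set T2) (f : T1 -> R[i]) (g : T2 -> R[i]).
Hypothesis mD1 : measurable D1.
Hypothesis mD2 : measurable D2.
Hypothesis f_int : cintegrable m1 D1 f.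
Hypothesis g_int : cintegrable m2 D2 g.

Let mD12 : measurable (D1 `*` D2). Proof. exact: measurableX. Qed.

Lemma cintegrable_tensor :
  cintegrable (m1 \x m2)%E (D1 `*` D2) (fun u => f u.1 * g u.2).
Proof.
have [fr fi] := f_int; have [gr gi] := g_int.
have rr := integrable_tensor mD1 mD2 fr gr; have ii := integrable_tensor mD1 mD2 fi gi.
have ri := integrable_tensor mD1 mD2 fr gi; have ir := integrable_tensor mD1 mD2 fi gr.
split.
- have := integrable_lincomb mD12 1 (-1) rr ii.
  by apply: eq_integrable => // t _; rewrite complexReM; congr EFin; ring.
- have := integrable_lincomb mD12 1 1 ri ir.
  by apply: eq_integrable => // t _; rewrite complexImM; congr EFin; ring.
Qed.

Lemma cintegral_tensor :
  cintegral (m1 \x m2)%E (D1 `*` D2) (fun u => f u.1 * g u.2) =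
  cintegral m1 D1 f * cintegral m2 D2 g.
Proof.
have [fr fi] := f_int; have [gr gi] := g_int.
have rr := integrable_tensor mD1 mD2 fr gr; have ii := integrable_tensor mD1 mD2 fi gi.
have ri := integrable_tensor mD1 mD2 fr gi; have ir := integrable_tensor mD1 mD2 fi gr.
apply/eqP; rewrite eq_complex complexReM complexImM /=.
rewrite -!(Rintegral_tensor mD1 mD2) //.
apply/andP; split; apply/eqP.
- rewrite -mulN1r -[X in X + _]mul1r -(Rintegral_lincomb mD12) //.
  by apply: eq_Rintegral => u _; rewrite complexReM; ring.
- rewrite -[X in X + _]mul1r -[X in _ + X]mul1r -(Rintegral_lincomb mD12) //.
  by apply: eq_Rintegral => u _; rewrite complexImM; ring.
Qed.

End TensorComplexIntegral.

(** Needed because [x + y] cancels its inverse only away from the origin, where the inverse has the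
    default value [0]. *)
Lemma cintegral_eq_off_null {R : realType} {d} {T : measurableType d}
    {mu : {measure set T -> \bar R}} {D : set T} (N : set T) (f g : T -> R[i]) :
  measurable D -> measurable N -> mu N = 0%E ->
  cintegrable mu D f -> cintegrable mu D g ->
  (forall t, D t -> ~ N t -> f t = g t) -> cintegral mu D f = cintegral mu D g.
Proof.
move=> mD mN N0 [fr fi] [gr gi] fg.
have ae_fg (h : R[i] -> R) :
    ae_eq mu D (fun t => (h (f t))%:E) (fun t => (h (g t))%:E).
  exists N; split => // t /= nfg; apply: contrapT => nNt; apply: nfg => Dt.
  by rewrite fg.
congr Complex; congr fine; apply: ae_eq_integral => //.
- exact: measurable_int fr.
- exact: measurable_int gr.
- exact: measurable_int fi.
- exact: measurable_int gi.
Qed.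

(** * The Cauchy pairing *)

Section CauchyBiorthogonal.
Context {R : realType}.
Variables (S1 S2 : set R) (w1 w2 : R -> R).
Hypothesis hw1 : density_supported_on S1 w1.
Hypothesis hw2 : density_supported_on S2 w2.
Hypothesis hm1 : finite_moments S1 w1.
Hypothesis hm2 : finite_moments S2 w2.
Hypothesis hm12 : finite_bimoments S1 S2 w1 w2.
Implicit Types (p q : {poly R[i]}) (x y z : R[i]).

Notation leb := (@lebesgue_measure R).
Notation leb2 := ((@lebesgue_measure R) \x (@lebesgue_measure R))%E.

Definition poly_pairing p q : R[i] :=
  pairing S1 S2 w1 w2 (fun s => p.[s%:C]) (fun s => q.[s%:C]).

Let cS1 : closed S1. Proof. by case: hw1. Qed.
Let cS2 : closed S2. Proof. by case: hw2. Qed.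
(* [lebesgue_measure] lives on the copy [measurableTypeR R] of [R], whose display
   is only convertible to the canonical one, which unification does not see. *)
Let mS1 : measurable (S1 : set (measurableTypeR R)). Proof. exact: closed_measurable. Qed.
Let mS2 : measurable (S2 : set (measurableTypeR R)). Proof. exact: closed_measurable. Qed.
Let mS12 : measurable (S1 `*` S2 : set (measurableTypeR R * measurableTypeR R)).
Proof. exact: measurableX. Qed.

Let ker (u : R * R) : R[i] := (w1 u.1 * w2 u.2 / (u.1 + u.2))%:C.

Let moment_int (S : set R) (w : R -> R)
    (mS : measurable (S : set (measurableTypeR R))) (hm : finite_moments S w) j :
  cintegrable leb S (fun s => (w s)%:C * s%:C ^+ j).
Proof.
apply: (eq_cintegrable mS _ (cintegrable_real (hm j))) => s _.
by rewrite rmorphM rmorphXn.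
Qed.

Let mean_int (S : set R) (w : R -> R)
    (mS : measurable (S : set (measurableTypeR R))) (hm : finite_moments S w) p :
  cintegrable leb S (fun s => (w s)%:C * p.[s%:C]).
Proof. by apply: (cintegrable_horner mS (e := idfun)) => j; exact: moment_int. Qed.

Let bimoment_int j k :
  cintegrable leb2 (S1 `*` S2) (fun u => ker u * u.1%:C ^+ j * u.2%:C ^+ k).
Proof.
apply: (eq_cintegrable mS12 _ (cintegrable_real (hm12 j k))) => u _.
by rewrite /ker 2!rmorphM !rmorphXn.
Qed.

(** The polynomial in the other variable is treated as part of the weight, so that the Horner
    induction runs in one variable at a time. *)
Let bimoment_int_l q j :
  cintegrable leb2 (S1 `*` S2) (fun u => ker u * q.[u.2%:C] * u.1%:C ^+ j).
Proof.
apply: (eq_cintegrable mS12 (f := fun u => ker u * u.1%:C ^+ j * q.[u.2%:C])) => [u _|].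
  by rewrite mulrAC.
by apply: (cintegrable_horner mS12 (e := snd)) => k; exact: bimoment_int.
Qed.

Let bimoment_int_r p j :
  cintegrable leb2 (S1 `*` S2) (fun u => ker u * p.[u.1%:C] * u.2%:C ^+ j).
Proof.
apply: (eq_cintegrable mS12 (f := fun u => ker u * u.2%:C ^+ j * p.[u.1%:C])) => [u _|].
  by rewrite mulrAC.
apply: (cintegrable_horner mS12 (e := fst)) => k.
by apply: (eq_cintegrable mS12 _ (bimoment_int k j)) => u _; rewrite mulrAC.
Qed.

Let pairing_int p q :
  cintegrable leb2 (S1 `*` S2) (fun u => ker u * p.[u.1%:C] * q.[u.2%:C]).
Proof. by apply: (cintegrable_horner mS12 (e := snd)) => k; exact: bimoment_int_r. Qed.

Lemma poly_pairing_scalarl q : scalar (poly_pairing^~ q).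
Proof.
apply: eq_scalar (cintegral_horner_scalar mS12 (e := fst) (bimoment_int_l q)) => p.
by apply: eq_cintegral => u _; rewrite mulrAC.
Qed.

Lemma poly_pairing_scalarr p : scalar (poly_pairing p).
Proof. exact: (cintegral_horner_scalar mS12 (e := snd) (bimoment_int_r p)). Qed.

(* The numerator [x + y] cancels the Cauchy kernel, and the integral factors. *)
Lemma poly_pairing_mulX p q :
  poly_pairing ('X * p) q + poly_pairing p ('X * q) = mean S1 w1 p * mean S2 w2 q.
Proof.
rewrite -[X in X + _]mul1r -[X in _ + X]mul1r.
rewrite -(cintegral_lincomb mS12); [|exact: pairing_int..].
rewrite -(cintegral_tensor mS1 mS2); [|exact: mean_int..].
(* Both supports lie in the nonnegative half-line, so [s + t = 0] happens at most at the origin, a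
   null set. *)
pose O : set (measurableTypeR R * measurableTypeR R) := [set 0] `*` [set 0].
apply: (@cintegral_eq_off_null _ _ _ leb2 (S1 `*` S2) O) => //.
- exact: measurableX.
- apply: etrans (product_measure1E leb leb _ _) _ => //.
  by rewrite [X in (X * _)%E](_ : _ = 0%E) ?mul0e //; exact: lebesgue_measure_set1.
- by apply: cintegrable_lincomb => //; exact: pairing_int.
- exact: (cintegrable_tensor mS1 mS2 (mean_int mS1 hm1 p) (mean_int mS2 hm2 q)).
move=> [s t] [/= S1s S2t] st0; rewrite !(mulrC 'X) !hornerMX /=.
have s0 : 0 <= s by case: hw1 => _ + _; exact.
have t0 : 0 <= t by case: hw2 => _ + _; exact.
have st_neq0 : s + t != 0.
  by rewrite paddr_eq0 //; apply/negP => /andP[/eqP s0' /eqP t0']; exact: st0.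
have : (w1 s * w2 t / (s + t))%:C * (s%:C + t%:C) = (w1 s)%:C * (w2 t)%:C.
  by rewrite -rmorphD -!rmorphM divfK.
move=> e; transitivity ((w1 s * w2 t / (s + t))%:C * (s%:C + t%:C) * p.[s%:C] * q.[t%:C]).
  by ring.
by rewrite e; ring.
Qed.

(** * Cauchy transforms: linearity and multiplication by the variable *)

Let cauchy1_int (S : set R) (w : R -> R)
    (mS : measurable (S : set (measurableTypeR R))) (cS : closed S)
    (hm : finite_moments S w) z j :
  off_support S z -> cintegrable leb S (fun s => (w s)%:C / (z - s%:C) * s%:C ^+ j).
Proof.
move=> Sz; have := cintegrable_resolvent mS cS Sz (@measurable_id _ _ S)
  (fun s Ss => Ss) (moment_int mS hm j).
by apply: (eq_cintegrable mS) => s _; rewrite mulrAC.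
Qed.

Lemma cauchy1_scalar (S : set R) (w : R -> R) z :
  closed S -> finite_moments S w -> off_support S z ->
  scalar (fun p => cauchy1 S w p z).
Proof.
move=> cS hm Sz; have mS : measurable (S : set (measurableTypeR R)) by exact: closed_measurable.
by apply: (cintegral_horner_scalar mS (e := idfun)) => j; exact: cauchy1_int.
Qed.

Lemma cauchy1_mulX (S : set R) (w : R -> R) z p :
  closed S -> finite_moments S w -> off_support S z ->
  cauchy1 S w ('X * p) z = z * cauchy1 S w p z - mean S w p.
Proof.
move=> cS hm Sz; have mS : measurable (S : set (measurableTypeR R)) by exact: closed_measurable.
apply: (cauchy_horner_mulX mS (e := idfun)) => // j; first exact: moment_int.
exact: cauchy1_int.
Qed.

Lemma cauchy2_xE p z : cauchy2_x S1 S2 w1 w2 p z =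
  cintegral leb2 (S1 `*` S2) (fun u => ker u / (z - u.1%:C) * p.[u.1%:C]).
Proof. by apply: eq_cintegral => u _; rewrite mulr1 mulrA mulrAC. Qed.

Lemma cauchy2_yE q z : cauchy2_y S1 S2 w1 w2 q z =
  cintegral leb2 (S1 `*` S2) (fun u => ker u / (z - u.2%:C) * q.[u.2%:C]).
Proof. by apply: eq_cintegral => u _; rewrite mulr1 mulrA mulrAC. Qed.

Let cauchy2_x_int z j : off_support S1 z ->
  cintegrable leb2 (S1 `*` S2) (fun u => ker u / (z - u.1%:C) * u.1%:C ^+ j).
Proof.
move=> Sz; have := cintegrable_resolvent mS12 cS1 Sz
  (measurable_funTS measurable_fst) (fun u => @proj1 _ _) (bimoment_int j 0).
by apply: (eq_cintegrable mS12) => u _; rewrite expr0 mulr1 mulrAC.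
Qed.

Let cauchy2_y_int z j : off_support S2 z ->
  cintegrable leb2 (S1 `*` S2) (fun u => ker u / (z - u.2%:C) * u.2%:C ^+ j).
Proof.
move=> Sz; have := cintegrable_resolvent mS12 cS2 Sz
  (measurable_funTS measurable_snd) (fun u => @proj2 _ _) (bimoment_int 0 j).
by apply: (eq_cintegrable mS12) => u _; rewrite expr0 mulr1 mulrAC.
Qed.

Lemma cauchy2_x_scalar z : off_support S1 z ->
  scalar (fun p => cauchy2_x S1 S2 w1 w2 p z).
Proof.
move=> Sz; have := cintegral_horner_scalar mS12 (fun j => cauchy2_x_int j Sz).
by apply: eq_scalar => p; rewrite cauchy2_xE.
Qed.

Lemma cauchy2_y_scalar z : off_support S2 z ->
  scalar (fun q => cauchy2_y S1 S2 w1 w2 q z).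
Proof.
move=> Sz; have := cintegral_horner_scalar mS12 (fun j => cauchy2_y_int j Sz).
by apply: eq_scalar => p; rewrite cauchy2_yE.
Qed.

(** The defect is a pairing with the constant [1], the form to which the reproducing property
    applies. *)
Lemma cauchy2_x_mulX z p : off_support S1 z ->
  cauchy2_x S1 S2 w1 w2 ('X * p) z =
  z * cauchy2_x S1 S2 w1 w2 p z - poly_pairing p 1.
Proof.
move=> Sz; rewrite !cauchy2_xE (cauchy_horner_mulX mS12 (e := fst)).
- by congr (_ - _); apply: eq_cintegral => u _; rewrite hornerC mulr1.
- by move=> u [] /= /Sz.
- by move=> j; apply: (eq_cintegrable mS12 _ (bimoment_int j 0)) => u _; rewrite expr0 mulr1.
- by move=> j; exact: cauchy2_x_int.
Qed.

Lemma cauchy2_y_mulX z q : off_support S2 z ->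
  cauchy2_y S1 S2 w1 w2 ('X * q) z =
  z * cauchy2_y S1 S2 w1 w2 q z - poly_pairing 1 q.
Proof.
move=> Sz; rewrite !cauchy2_yE (cauchy_horner_mulX mS12 (e := snd)).
- by congr (_ - _); apply: eq_cintegral => u _; rewrite hornerC mulr1.
- by move=> u [] /= _ /Sz.
- by move=> j; apply: (eq_cintegrable mS12 _ (bimoment_int 0 j)) => u _; rewrite expr0 mulr1.
- by move=> j; exact: cauchy2_y_int.
Qed.

(** * Christoffel-Darboux for the Cauchy biorthogonal polynomials *)

Variables (P Q : nat -> {poly R[i]}) (S : nat -> R[i]).
Hypothesis hPQ : biorthogonal S1 S2 w1 w2 P Q S.

Lemma hatP_scalar (phi : {poly R[i]} -> R[i]) n : scalar phi ->
  phi (hatP S2 w2 P Q n) = - \sum_(k < n.+1) mean S2 w2 (Q k) * phi (P k).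
Proof. by move=> phi_s; rewrite scalarN // (scalar_sum phi_s _ (mean S2 w2 \o Q)). Qed.

Lemma checkQ_scalar (psi : {poly R[i]} -> R[i]) n : scalar psi ->
  psi (checkQ S1 w1 P Q n) = - \sum_(j < n.+1) mean S1 w1 (P j) * psi (Q j).
Proof. by move=> psi_s; rewrite scalarN // (scalar_sum psi_s _ (mean S1 w1 \o P)). Qed.

Lemma cauchy_christoffel_darboux (phi psi alpha beta : {poly R[i]} -> R[i]) x y n :
  scalar phi -> scalar psi ->
  (forall p, phi ('X * p) = x * phi p - alpha p) ->
  (forall q, psi ('X * q) = y * psi q - beta q) ->
  (x + y) * \sum_(l < n.+1) phi (P l) * psi (Q l)
  = phi (hatP S2 w2 P Q n) * psi (checkQ S1 w1 P Q n)
    + S n / S n.+1 * (phi (P n) * psi (Q n.+1) + phi (P n.+1) * psi (Q n))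
    + \sum_(l < n.+1) alpha (P l) * psi (Q l)
    + \sum_(l < n.+1) beta (Q l) * phi (P l).
Proof.
move=> phi_s psi_s phiX psiX; have [sizeP sizeQ _ PQ] := hPQ.
(* The minus signs in [hatP] and [checkQ] cancel in the rank-one product. *)
rewrite hatP_scalar // checkQ_scalar // mulrNN.
exact: (christoffel_darboux_defect poly_pairing_scalarl poly_pairing_scalarr
  poly_pairing_mulX sizeP sizeQ PQ n phi_s psi_s phiX psiX).
Qed.

Lemma poly_pairing_reproducing_r (psi : {poly R[i]} -> R[i]) n : scalar psi ->
  \sum_(l < n.+1) poly_pairing (P l) 1 * psi (Q l) = psi 1.
Proof.
have [_ sizeQ _ PQ] := hPQ.
exact: (biorth_reproducing_one_r poly_pairing_scalarr sizeQ PQ).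
Qed.

Lemma poly_pairing_reproducing_l (phi : {poly R[i]} -> R[i]) n : scalar phi ->
  \sum_(l < n.+1) poly_pairing 1 (Q l) * phi (P l) = phi 1.
Proof.
have [sizeP _ _ PQ] := hPQ.
exact: (biorth_reproducing_one_l poly_pairing_scalarl sizeP PQ).
Qed.

End CauchyBiorthogonal.

(** * The eight kernel identities *)

Theorem corollary3p1 (R : realType) (S1 S2 : set R) (w1 w2 : R -> R)
  (P Q : nat -> {poly R[i]}) (S : nat -> R[i])
  (hw1 : density_supported_on S1 w1) (hw2 : density_supported_on S2 w2)
  (hm1 : finite_moments S1 w1) (hm2 : finite_moments S2 w2)
  (hm12 : finite_bimoments S1 S2 w1 w2)
  (hZ : forall n, Z S1 S2 w1 w2 n != 0)
  (hPQ : biorthogonal S1 S2 w1 w2 P Q S)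
  (hpi : forall n, mean S1 w1 (P n) != 0)
  (heta : forall n, mean S2 w2 (Q n) != 0)
  (n : nat) (x y : R[i]) (hxy : x + y != 0) :
  let hP := hatP S2 w2 P Q n in
  let cQ := checkQ S1 w1 P Q n in
  let P1 := cauchy1 S1 w1 in
  let P2 := cauchy2_x S1 S2 w1 w2 in
  let Q1 := cauchy1 S2 w2 in
  let Q2 := cauchy2_y S1 S2 w1 w2 in
  (off_support S2 y ->
     (x + y) * K01 S2 w2 P Q n x y =
       hP.[x] * (Q1 cQ y - 1)
       + S n / S n.+1 * ((P n).[x] * Q1 (Q n.+1) y + (P n.+1).[x] * Q1 (Q n) y))
  /\ (off_support S1 x ->
     (x + y) * K10 S1 w1 P Q n x y =
       (P1 hP x - 1) * cQ.[y]
       + S n / S n.+1 * (P1 (P n) x * (Q n.+1).[y] + P1 (P n.+1) x * (Q n).[y]))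
  /\ (off_support S1 x -> off_support S2 y ->
     (x + y) * K11 S1 S2 w1 w2 P Q n x y =
       (P1 hP x - 1) * (Q1 cQ y - 1)
       + S n / S n.+1 * (P1 (P n) x * Q1 (Q n.+1) y + P1 (P n.+1) x * Q1 (Q n) y))
  /\ (off_support S2 y ->
     (x + y) * K02 S1 S2 w1 w2 P Q n x y =
       hP.[x] * Q2 cQ y
       + S n / S n.+1 * ((P n).[x] * Q2 (Q n.+1) y + (P n.+1).[x] * Q2 (Q n) y))
  /\ (off_support S1 x -> off_support S2 y ->
     (x + y) * K12 S1 S2 w1 w2 P Q n x y =
       (P1 hP x - 1) * Q2 cQ y
       + S n / S n.+1 * (P1 (P n) x * Q2 (Q n.+1) y + P1 (P n.+1) x * Q2 (Q n) y))
  /\ (off_support S1 x ->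
     (x + y) * K20 S1 S2 w1 w2 P Q n x y =
       P2 hP x * cQ.[y]
       + S n / S n.+1 * (P2 (P n) x * (Q n.+1).[y] + P2 (P n.+1) x * (Q n).[y]))
  /\ (off_support S1 x -> off_support S2 y ->
     (x + y) * K21 S1 S2 w1 w2 P Q n x y =
       P2 hP x * (Q1 cQ y - 1)
       + S n / S n.+1 * (P2 (P n) x * Q1 (Q n.+1) y + P2 (P n.+1) x * Q1 (Q n) y))
  /\ (off_support S1 x -> off_support S2 y ->
     (x + y) * K22 S1 S2 w1 w2 P Q n x y =
       P2 hP x * Q2 cQ y
       + S n / S n.+1 * (P2 (P n) x * Q2 (Q n.+1) y + P2 (P n.+1) x * Q2 (Q n) y)).
Proof.
move=> hP cQ; cbv zeta.
have cS1 : closed S1 by case: hw1.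
have cS2 : closed S2 by case: hw2.
have CD := cauchy_christoffel_darboux hw1 hw2 hm1 hm2 hm12 hPQ.
have reprr psi := poly_pairing_reproducing_r hw1 hw2 hm12 hPQ (psi := psi).
have reprl phi := poly_pairing_reproducing_l hw1 hw2 hm12 hPQ (phi := phi).
have P0s := horner_scalar x; have Q0s := horner_scalar y.
have P0X (p : {poly R[i]}) : ('X * p).[x] = x * p.[x] - 0.
  by rewrite horner_mulX subr0.
have Q0X (q : {poly R[i]}) : ('X * q).[y] = y * q.[y] - 0.
  by rewrite horner_mulX subr0.
have P1s Sx := cauchy1_scalar cS1 hm1 (z := x) Sx.
have Q1s Sy := cauchy1_scalar cS2 hm2 (z := y) Sy.
have P1X Sx p := cauchy1_mulX p cS1 hm1 (z := x) Sx.
have Q1X Sy q := cauchy1_mulX q cS2 hm2 (z := y) Sy.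
have P2s Sx := cauchy2_x_scalar hw1 hw2 hm12 (z := x) Sx.
have Q2s Sy := cauchy2_y_scalar hw1 hw2 hm12 (z := y) Sy.
have P2X Sx p := cauchy2_x_mulX hw1 hw2 hm12 p (z := x) Sx.
have Q2X Sy q := cauchy2_y_mulX hw1 hw2 hm12 q (z := y) Sy.
have zero_sum (f : 'I_n.+1 -> R[i]) : \sum_(l < n.+1) 0 * f l = 0.
  by apply: big1 => l _; rewrite mul0r.
have eta_sum phi : scalar phi ->
    \sum_(k < n.+1) mean S2 w2 (Q k) * phi (P k) = - phi hP.
  by move=> phi_s; rewrite hatP_scalar // opprK.
have pi_sum psi : scalar psi ->
    \sum_(j < n.+1) mean S1 w1 (P j) * psi (Q j) = - psi cQ.
  by move=> psi_s; rewrite checkQ_scalar // opprK.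
(* Multiplied by [x + y], the rational correction of each kernel becomes a term [c] to be matched
   with the defect sums. *)
have kernel_sub (s c : R[i]) : (x + y) * (s - c / (x + y)) = (x + y) * s - c.
  by field.
do ![split].
(* Evaluation has no defect; the defect of [Q1] sums to [- hP.[x]], which produces the [- 1] in the
   second factor. *)
- move=> Sy; rewrite /K01 (CD _ _ _ _ _ _ _ P0s (Q1s Sy) P0X (Q1X Sy)).
  by rewrite zero_sum (eta_sum _ P0s) -/hP -/cQ; cbv beta; ring.
- move=> Sx; rewrite /K10 (CD _ _ _ _ _ _ _ (P1s Sx) Q0s (P1X Sx) Q0X).
  by rewrite zero_sum (pi_sum _ Q0s) -/hP -/cQ; cbv beta; ring.
(* Here [c = -1]: the resulting [+ 1] and the two defect sums complete the product of the two
   factors shifted by [- 1]. *)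
- move=> Sx Sy; rewrite /K11 -[1 / _]opprK -mulNr kernel_sub.
  rewrite (CD _ _ _ _ _ _ _ (P1s Sx) (Q1s Sy) (P1X Sx) (Q1X Sy)).
  by rewrite (eta_sum _ (P1s Sx)) (pi_sum _ (Q1s Sy)) -/hP -/cQ; cbv beta; ring.
(* The defect of [Q2] reproduces the constant [1] evaluated at [x], and this cancels [c = 1]. *)
- move=> Sy; rewrite /K02 kernel_sub (CD _ _ _ _ _ _ _ P0s (Q2s Sy) P0X (Q2X Sy)).
  by rewrite zero_sum (reprl _ _ P0s) hornerC -/hP -/cQ; cbv beta; ring.
(* The defect of [P1] supplies the shift by [- 1], while that of [Q2] sums to [f1 x] and cancels the
   correction. *)
- move=> Sx Sy; rewrite /K12 kernel_sub.
  rewrite (CD _ _ _ _ _ _ _ (P1s Sx) (Q2s Sy) (P1X Sx) (Q2X Sy)).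
  by rewrite (pi_sum _ (Q2s Sy)) (reprl _ _ (P1s Sx)) /f1 -/hP -/cQ; cbv beta; ring.
- move=> Sx; rewrite /K20 kernel_sub (CD _ _ _ _ _ _ _ (P2s Sx) Q0s (P2X Sx) Q0X).
  by rewrite zero_sum (reprr _ _ Q0s) hornerC -/hP -/cQ; cbv beta; ring.
- move=> Sx Sy; rewrite /K21 kernel_sub.
  rewrite (CD _ _ _ _ _ _ _ (P2s Sx) (Q1s Sy) (P2X Sx) (Q1X Sy)).
  by rewrite (eta_sum _ (P2s Sx)) (reprr _ _ (Q1s Sy)) /f2 -/hP -/cQ; cbv beta; ring.
(* Both defects are of reproducing type: they sum to [g2 y] and [g1 x], so neither factor is
   shifted. *)
- move=> Sx Sy; rewrite /K22 kernel_sub.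
  rewrite (CD _ _ _ _ _ _ _ (P2s Sx) (Q2s Sy) (P2X Sx) (Q2X Sy)).
  by rewrite (reprr _ _ (Q2s Sy)) (reprl _ _ (P2s Sx)) /g1 /g2 -/hP -/cQ; cbv beta; ring.
Qed.
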